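(* (Semantic soundness for System F with general recursion.) Let $e$ be an expression, $A$ a type, $\Gamma$ a type environment, $\rho$ an environment (partial map from variables to $\mathbb{D}$) and $\eta$ a finite sequence of subsets of $\mathbb{D}$. If $\Gamma\vdash e:A$ and $\vdash\rho,\eta:\Gamma$, then $\mathcal{E}[\![e]\!]\rho\subseteq\mathcal{T}[\![A]\!]\eta$.
   Context: **Syntax.** Types $A,B,C ::= \mathtt{int}\mid A\to B\mid\forall A\mid i$, with $i\in\mathbb{N}$ a DeBruijn index ($\forall$ binds implicitly). Expressions $e ::= n\mid e\oplus e\mid x\mid\lambda x{:}A.\,e\mid e\;e\mid\Lambda e\mid e[A]\mid\mathtt{fix}\,x{:}A.\,e$, with $n\in\mathbb{Z}$, $\oplus$ total integer operations. **Shift and substitution on types.** $\uparrow^k_c(j)=j$ if $j<c$, $j+k$ if $j\ge c$; $\uparrow^k_c(\forall A)=\forall(\uparrow^k_{c+1}(A))$; homomorphic on $\to$ and $\mathtt{int}$. $[i\mapsto B]j$ equals $B$ if $j=i$, $j$ if $j<i$, $j-1$ if $j>i$; $[i\mapsto B](\forall A)=\forall([i+1\mapsto\uparrow^1_0(B)]A)$; homomorphic on $\to$ and $\mathtt{int}$. **Type environments.** $\Gamma$ is a pair of a partial map $\mathsf{fst}(\Gamma)$ from variables to pairs (type, natural number) and a natural number $\mathsf{snd}(\Gamma)$ (number of enclosing type binders). $\mathsf{empty}=(\emptyset,0)$; $\mathsf{extend}(\Gamma,x,A)=(\mathsf{fst}(\Gamma)(x{:=}(A,\mathsf{snd}(\Gamma))),\mathsf{snd}(\Gamma))$;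 $\mathsf{tyExtend}(\Gamma)=(\mathsf{fst}(\Gamma),\mathsf{snd}(\Gamma)+1)$; $\mathsf{lookup}(\Gamma,x)=\uparrow^{k-j}_0(A)$ where $(A,j)=\mathsf{fst}(\Gamma)(x)$, $k=\mathsf{snd}(\Gamma)$. **Typing** $\Gamma\vdash e:A$ is inductively defined by: $\Gamma\vdash n:\mathtt{int}$; $\Gamma\vdash x:\mathsf{lookup}(\Gamma,x)$ (for $x\in\mathrm{dom}(\mathsf{fst}(\Gamma))$); if $\mathsf{extend}(\Gamma,x,A)\vdash e:B$ then $\Gamma\vdash\lambda x{:}A.e:A\to B$; if $\mathsf{extend}(\Gamma,x,A\to B)\vdash e:A\to B$ then $\Gamma\vdash\mathtt{fix}\,x{:}A{\to}B.\,e:A\to B$; if $\Gamma\vdash e:A\to B$ and $\Gamma\vdash e':A$ then $\Gamma\vdash e\,e':B$; if $\mathsf{tyExtend}(\Gamma)\vdash e:A$ then $\Gamma\vdash\Lambda e:\forall A$; if $\Gamma\vdash e:\forall A$ then $\Gamma\vdash e[B]:[0\mapsto B]A$. **Domain.** $\mathbb{D}$ is the inductively defined set of elements $d ::= n\mid t\mid\mathsf{thunk}(o)\mid\mathsf{wrong}$, where $n\in\mathbb{Z}$, $t$ is a finite set of pairs of elements (a table), and $o ::= \mathsf{none}\mid\mathsf{some}(d)$. Order $\sqsubseteq$ (least relation): $n\sqsubseteq n$; $t\sqsubseteq t'$ if $t\subseteq t'$; $\mathsf{thunk}(\mathsf{none})\sqsubseteq\mathsf{thunk}(\mathsf{none})$;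 $\mathsf{thunk}(\mathsf{some}(d))\sqsubseteq\mathsf{thunk}(\mathsf{some}(d'))$ if $d\sqsubseteq d'$; $\mathsf{wrong}\sqsubseteq\mathsf{wrong}$. **Set monad.** $X\leftarrow m_1;m_2$ denotes $\{b\mid\exists a\in m_1.\ b\in m_2[X:=a]\}$; $\mathsf{return}\,a=\{a\}$; $\mathsf{zero}=\emptyset$; $\mathsf{down}\,d=\{d'\in\mathbb{D}\mid d'\sqsubseteq d\}$; $X:=m_1;m_2$ denotes $X\leftarrow m_1;\ \mathbf{if}\ X=\mathsf{wrong}\ \mathbf{then}\ \mathsf{return}\,\mathsf{wrong}\ \mathbf{else}\ m_2$. For finite sets, $\mathsf{mapM}\,\emptyset\,f=\mathsf{return}\,\emptyset$ and $\mathsf{mapM}\,(\{a\}\uplus as)\,f=(b\leftarrow f(a);\ bs\leftarrow\mathsf{mapM}\,as\,f;\ \mathsf{return}\,(\{b\}\cup bs))$. **Semantics** $\mathcal{E}[\![e]\!]\rho\subseteq\mathbb{D}$: - $\mathcal{E}[\![n]\!]\rho=\mathsf{return}\,n$; $\mathcal{E}[\![x]\!]\rho=\mathsf{down}\,\rho(x)$; - $\mathcal{E}[\![e_1\oplus e_2]\!]\rho=(d_1:=\mathcal{E}[\![e_1]\!]\rho;\ d_2:=\mathcal{E}[\![e_2]\!]\rho;$ if $d_1,d_2$ are integers $n_1,n_2$ then $\mathsf{return}\,(n_1\oplus n_2)$ else $\mathsf{return}\,\mathsf{wrong})$; - $\mathcal{E}[\![\lambda x{:}A.e]\!]\rho=(ds\leftarrow\mathcal{P}_f(\mathbb{D});\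 \mathsf{mapM}\,ds\,(\lambda d.\ d'\leftarrow\mathcal{E}[\![e]\!]\rho(x{:=}d);\ \mathsf{return}\,(d,d')))$, where $\mathcal{P}_f(\mathbb{D})$ is the set of finite subsets of $\mathbb{D}$; - $\mathcal{E}[\![e_1\,e_2]\!]\rho=\mathsf{apply}(\mathcal{E}[\![e_1]\!]\rho,\mathcal{E}[\![e_2]\!]\rho)$, where $\mathsf{apply}(D_1,D_2)=(d_1:=D_1;\ d_2:=D_2;$ if $d_1$ is a table $t$ then $((d,d')\leftarrow t;\ \mathbf{if}\ d\sqsubseteq d_2\ \mathbf{then}\ \mathsf{down}\,d'\ \mathbf{else}\ \mathsf{zero})$ else $\mathsf{return}\,\mathsf{wrong})$; - $\mathcal{E}[\![\mathtt{fix}\,x{:}A.e]\!]\rho=(k\leftarrow\mathbb{N};\ \mathsf{iterate}(k,x,\mathcal{E}[\![e]\!],\rho))$, where $\mathsf{iterate}(0,x,L,\rho)=\mathsf{zero}$ and $\mathsf{iterate}(k+1,x,L,\rho)=(d:=\mathsf{iterate}(k,x,L,\rho);\ L\,\rho(x{:=}d))$; - $\mathcal{E}[\![\Lambda e]\!]\rho=\mathsf{return}\,\mathsf{thunk}(\mathsf{none})$ if $\mathcal{E}[\![e]\!]\rho=\emptyset$, else $(d:=\mathcal{E}[\![e]\!]\rho;\ \mathsf{return}\,\mathsf{thunk}(\mathsf{some}(d)))$; - $\mathcal{E}[\![e[A]]\!]\rho=(x:=\mathcal{E}[\![e]\!]\rho;$ case $x$ of $\mathsf{thunk}(\mathsf{none})\Rightarrow\mathsf{zero}$;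 $\mathsf{thunk}(\mathsf{some}(d))\Rightarrow\mathsf{down}\,d$; otherwise $\mathsf{return}\,\mathsf{wrong})$. **Semantics of types.** For a finite sequence $\eta=\eta_0\eta_1\cdots$ of subsets of $\mathbb{D}$, with length $|\eta|$ and $D\eta$ denoting $\eta$ with $D$ prepended: - $\mathcal{T}[\![\mathtt{int}]\!]\eta=\mathbb{Z}$; $\mathcal{T}[\![i]\!]\eta=\mathsf{cleanup}(\eta_i)$ if $i<|\eta|$, else $\emptyset$; - $\mathcal{T}[\![A\to B]\!]\eta=\{t\mid\forall(d_1,d_2')\in t.\ d_1\in\mathcal{T}[\![A]\!]\eta\Rightarrow\exists d_2\in\mathcal{T}[\![B]\!]\eta.\ d_2'\sqsubseteq d_2\}$ ($t$ ranging over tables); - $\mathcal{T}[\![\forall A]\!]\eta=\{\mathsf{thunk}(\mathsf{some}(d))\mid\forall D\subseteq\mathbb{D}.\ d\in\mathcal{T}[\![A]\!](D\eta)\}\cup\{\mathsf{thunk}(\mathsf{none})\}$; where $\mathsf{cleanup}(D)=\{d\mid\exists d'\in D.\ d\sqsubseteq d'\wedge d\neq\mathsf{wrong}\}$. **Well-typed environments** $\vdash\rho,\eta:\Gamma$ is inductively defined by: $\vdash\emptyset,\emptyset:\mathsf{empty}$; if $\vdash\rho,\eta:\Gamma$ and $v\in\mathcal{T}[\![A]\!]\eta$ then $\vdash\rho(x{:=}v),\eta:\mathsf{extend}(\Gamma,x,A)$; if $\vdash\rho,\eta:\Gamma$ and $V\subseteq\mathbb{D}$ then $\vdash\rho,V\eta:\mathsf{tyExtend}(\Gamma)$.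 *)

(* Defs.v *)
From HB Require Import structures.
From mathcomp Require Import all_boot ssrint.
From mathcomp Require Import finmap.
From mathcomp Require Import boolp classical_sets.

Set Implicit Arguments.
Unset Strict Implicit.
Unset Printing Implicit Defensive.

Local Open Scope classical_set_scope.

(* The domain has to satisfy
     dom  =  int + {fset dom * dom} + option dom + {wrong},
   least such, with genuine (extensional) equality of tables.  Rocq has no
   inductive type nested through {fset _}, so [dom] is the subtype of those raw
   trees in which every table is listed in the canonical order of {fset _}.
   The raw trees are not meant to be used outside this construction: [num],
   [tbl], [thunk], [wrong], the destructor [view] with its computation rules,
   and [dom_ind] present [dom] as the inductive type above. *)

Inductive raw : Type :=
| RInt of int
| RTab of seq (raw * raw)
| RThunk of option raw
| RWrong.

Fixpoint raw_enc (r : raw) : GenTree.tree int :=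
  match r with
  | RInt n => GenTree.Leaf n
  | RTab s => GenTree.Node 0
      (map (fun p => let: (a, b) := p in
                     GenTree.Node 4 [:: raw_enc a; raw_enc b]) s)
  | RThunk None => GenTree.Node 1 [::]
  | RThunk (Some r) => GenTree.Node 2 [:: raw_enc r]
  | RWrong => GenTree.Node 3 [::]
  end.

Fixpoint raw_dec (t : GenTree.tree int) : raw :=
  match t with
  | GenTree.Leaf n => RInt n
  | GenTree.Node 0 s => RTab
      (map (fun u => match u with
                     | GenTree.Node 4 [:: a; b] => (raw_dec a, raw_dec b)
                     | _ => (RWrong, RWrong)
                     end) s)
  | GenTree.Node 1 _ => RThunk None
  | GenTree.Node 2 [:: u] => RThunk (Some (raw_dec u))
  | _ => RWrong
  end.

Lemma raw_encK : cancel raw_enc raw_dec.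
Proof.
rewrite /cancel; fix IH 1; case=> [n|s|[r|]|] //=.
- congr RTab; elim: s => [//|[a b] s IHs] /=.
  by rewrite IHs !IH.
- by rewrite IH.
Qed.

HB.instance Definition _ := Countable.copy raw (can_type raw_encK).

Fixpoint raw_wf (r : raw) : bool :=
  match r with
  | RTab s => (s == [fset p in s]%fset :> seq (raw * raw))
              && all (fun p => let: (a, b) := p in raw_wf a && raw_wf b) s
  | RThunk (Some r) => raw_wf r
  | _ => true
  end.

Record dom : Type := Dom { rawof : raw; _ : raw_wf rawof }.

HB.instance Definition _ := [isSub for rawof].
HB.instance Definition _ := [Countable of dom by <:].

Definition num (n : int) : dom := @Dom (RInt n) isT.

Definition wrong : dom := @Dom RWrong isT.

Lemma thunk_subproof (o : option dom) : raw_wf (RThunk (omap rawof o)).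
Proof. by case: o => [[]|]. Qed.

Definition thunk (o : option dom) : dom := Dom (thunk_subproof o).

Definition rawpair (p : dom * dom) : raw * raw := (rawof p.1, rawof p.2).

Lemma rawpair_inj : injective rawpair.
Proof. by move=> [a b] [c d] [/val_inj -> /val_inj ->]. Qed.

Lemma tbl_subproof (t : {fset dom * dom}) :
  raw_wf (RTab (enum_fset (rawpair @` t)%fset)).
Proof.
apply/andP; split.
  by apply/eqP; congr enum_fset; apply/fsetP => p; rewrite !inE.
apply/allP => p /imfsetP [[[a Ha] [b Hb]] /= _ ->].
exact/andP.
Qed.

Definition tbl (t : {fset dom * dom}) : dom := Dom (tbl_subproof t).

Variant dview : Type :=
| VNum of int
| VTbl of {fset dom * dom}
| VThunk of option dom
| VWrong.

Definition unrawpair (p : raw * raw) : option (dom * dom) :=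
  if insub p.1 is Some a then
    if insub p.2 is Some b then Some (a, b) else None
  else None.

Lemma rawpairK : pcancel rawpair unrawpair.
Proof. by move=> [a b]; rewrite /unrawpair /= !valK. Qed.

Definition view (d : dom) : dview :=
  match rawof d with
  | RInt n => VNum n
  | RTab s => VTbl [fset p in pmap unrawpair s]%fset
  | RThunk o => VThunk (obind insub o)
  | RWrong => VWrong
  end.

Lemma view_num n : view (num n) = VNum n.
Proof. by []. Qed.

Lemma view_wrong : view wrong = VWrong.
Proof. by []. Qed.

Lemma view_thunk o : view (thunk o) = VThunk o.
Proof. by case: o => [d|//]; rewrite /view /= valK. Qed.

Lemma view_tbl t : view (tbl t) = VTbl t.
Proof.
congr VTbl; apply/fsetP => p; rewrite !inE /= mem_pmap.
apply/mapP/idP => [[q /imfsetP [p' /= Hp' ->]]|Hp].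
  by rewrite rawpairK => -[->].
by exists (rawpair p); rewrite ?rawpairK // in_imfset.
Qed.

Definition viewE := (view_num, view_wrong, view_thunk, view_tbl).

Lemma raw_ind_nested (Q : raw -> Prop) :
  (forall n, Q (RInt n)) ->
  (forall s, (forall a b, (a, b) \in s -> Q a /\ Q b) -> Q (RTab s)) ->
  Q (RThunk None) ->
  (forall r, Q r -> Q (RThunk (Some r))) ->
  Q RWrong ->
  forall r, Q r.
Proof.
move=> Qint Qtab Qnone Qsome Qwrong; fix IH 1; case=> [n|s|[r|]|].
- exact: Qint.
- apply: Qtab; elim: s => [|[a b] s IHs] a' b'; first by rewrite in_nil.
  rewrite inE => /orP [/eqP [-> ->]|]; last exact: IHs.
  by split; apply: IH.
- exact/Qsome/IH.
- exact: Qnone.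
- exact: Qwrong.
Qed.

Lemma dom_ind (P : dom -> Prop) :
  (forall n, P (num n)) ->
  (forall t, (forall d d', (d, d') \in t -> P d /\ P d') -> P (tbl t)) ->
  P (thunk None) ->
  (forall d, P d -> P (thunk (Some d))) ->
  P wrong ->
  forall d, P d.
Proof.
move=> Pnum Ptbl Pnone Psome Pwrong [r wr].
elim/raw_ind_nested: r wr => [n|s IHs||r IHr|] wr.
- by have -> : Dom wr = num n by apply: val_inj.
- pose t := [fset p in pmap unrawpair s]%fset.
  have [/eqP sE /allP wfs] := andP wr.
  have -> : Dom wr = tbl t.
    apply: val_inj; congr RTab; rewrite sE; congr enum_fset.
    apply/fsetP => -[a b]; apply/idP/imfsetP => /=.
      rewrite inE => sab; have /andP [wa wb] := wfs _ sab.
      exists (Dom wa, Dom wb) => //; rewrite inE /= mem_pmap.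
      by apply/mapP; exists (a, b) => //; rewrite -(rawpairK (Dom wa, Dom wb)).
    case=> q; rewrite !inE /= mem_pmap => /mapP [[c d] scd].
    have /andP [wc wd] := wfs _ scd.
    by rewrite -[(c, d)]/(rawpair (Dom wc, Dom wd)) rawpairK => -[->] ->.
  apply: Ptbl => d d'; rewrite inE /= mem_pmap => /mapP [[a b] sab].
  have /andP [wa wb] := wfs _ sab; have [Pa Pb] := IHs _ _ sab.
  by rewrite -[(a, b)]/(rawpair (Dom wa, Dom wb)) rawpairK => -[-> ->].
- by have -> : Dom wr = thunk None by apply: val_inj.
- have -> : Dom wr = thunk (Some (@Dom r wr)) by apply: val_inj.
  exact/Psome/IHr.
- by have -> : Dom wr = wrong by apply: val_inj.
Qed.

Inductive dle : dom -> dom -> Prop :=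
| dle_num n : dle (num n) (num n)
| dle_tbl t t' : (t `<=` t')%fset -> dle (tbl t) (tbl t')
| dle_none : dle (thunk None) (thunk None)
| dle_some d d' : dle d d' -> dle (thunk (Some d)) (thunk (Some d'))
| dle_wrong : dle wrong wrong.

Notation "d1 '⊑' d2" := (dle d1 d2) (at level 70, no associativity).

Definition bind (A B : Type) (m : set A) (k : A -> set B) : set B :=
  [set b | exists2 a, m a & k a b].

Definition wbind (m : set dom) (k : dom -> set dom) : set dom :=
  bind m (fun d => if d == wrong then [set wrong] else k d).

Notation "x <~ m1 ;; m2" := (bind m1 (fun x => m2))
  (at level 100, x as name, m1 at next level, right associativity).

(* [x <~! m1 ;; m2] is the binder written X := m1; m2, which propagates
   [wrong]. *)
Notation "x <~! m1 ;; m2" := (wbind m1 (fun x => m2))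
  (at level 100, x as name, m1 at next level, right associativity).

Definition ddown (d : dom) : set dom := [set d' | d' ⊑ d].

(* The elements of [s] are taken in the canonical order of {fset _}; by
   [mapMU1] this satisfies the recursive equation for every decomposition
   {a} + s. *)
Definition mapM (A B : choiceType) (s : {fset A}) (f : A -> set B) :
    set {fset B} :=
  foldr (fun a m => b <~ f a ;; bs <~ m ;; [set (b |` bs)%fset])
    [set fset0] (enum_fset s).

Lemma mapM0 (A B : choiceType) (f : A -> set B) : mapM fset0 f = [set fset0].
Proof.
by rewrite /mapM; have := cardfs0 A; rewrite /card; case: (enum_fset fset0).
Qed.

Lemma mapMU1 (A B : choiceType) (a : A) (s : {fset A}) (f : A -> set B) :
  a \notin s ->
  mapM (a |` s)%fset f = (b <~ f a ;; bs <~ mapM s f ;; [set (b |` bs)%fset]).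
Proof.
move=> sa; rewrite /mapM; set step := fun _ _ => _.
have stepC x y m : step x (step y m) = step y (step x m).
  apply/seteqP; split=> r [b fb [bs [b' fb' [bs' mbs' ->]] ->]];
  by exists b' => //; exists (b |` bs')%fset; [exists b => //; exists bs'|];
     rewrite // fsetUCA.
have rem_step x l z : x \in l ->
    foldr step z l = step x (foldr step z (rem x l)).
  elim: l => //= y l IHl; rewrite inE; have [->//|_ /= /IHl ->] := eqVneq y x.
  by rewrite stepC.
have perm_step l1 l2 z : perm_eq l1 l2 -> foldr step z l1 = foldr step z l2.
  elim: l1 l2 => [|x l1 IHl1] l2 p12.
    by move: p12; rewrite perm_sym => /perm_nilP ->.
  have xl2 : x \in l2 by rewrite -(perm_mem p12) mem_head.
  rewrite (rem_step _ _ _ xl2) /= (IHl1 (rem x l2)) //.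
  by rewrite -(perm_cons x); apply: perm_trans p12 _; apply: perm_to_rem.
rewrite (perm_step _ (a :: enum_fset s)) //.
apply: uniq_perm => [||x]; rewrite /= ?fset_uniq ?andbT //.
by rewrite -[LHS]/(x \in (a |` s)%fset) !inE.
Qed.

(* De Bruijn types: [TAll], like [ETyAbs] below, binds index 0. *)
Inductive ty : Type :=
| TInt
| TFun of ty & ty
| TAll of ty
| TVar of nat.

(* [V] is the type of program variables and [EOp op] is the binary operator
   denoting the total integer operation [op]. *)
Inductive exp (V : Type) : Type :=
| EInt of int
| EOp of (int -> int -> int) & exp V & exp V
| EVar of V
| ELam of V & ty & exp V
| EApp of exp V & exp V
| ETyAbs of exp V
| ETyApp of exp V & ty
| EFix of V & ty & exp V.

Arguments EInt {V} _.

Fixpoint shift (k c : nat) (A : ty) : ty :=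
  match A with
  | TInt => TInt
  | TFun A B => TFun (shift k c A) (shift k c B)
  | TAll A => TAll (shift k c.+1 A)
  | TVar j => if j < c then TVar j else TVar (j + k)
  end.

Fixpoint subst (i : nat) (B : ty) (A : ty) : ty :=
  match A with
  | TInt => TInt
  | TFun A1 A2 => TFun (subst i B A1) (subst i B A2)
  | TAll A => TAll (subst i.+1 (shift 1 0 B) A)
  | TVar j => if j == i then B else if j < i then TVar j else TVar j.-1
  end.

Definition pfun_empty (V T : Type) : V -> option T := fun=> None.

Definition pfun_upd (V : eqType) (T : Type) (f : V -> option T) (x : V) (v : T)
    : V -> option T :=
  fun y => if y == x then Some v else f y.

Definition tyenv (V : Type) : Type := ((V -> option (ty * nat)) * nat)%type.

Definition tyenv_empty (V : Type) : tyenv V := (@pfun_empty V _, 0).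

Definition extend (V : eqType) (Gamma : tyenv V) (x : V) (A : ty) : tyenv V :=
  (pfun_upd Gamma.1 x (A, Gamma.2), Gamma.2).

Definition tyExtend (V : Type) (Gamma : tyenv V) : tyenv V :=
  (Gamma.1, Gamma.2.+1).

Definition lookup (V : Type) (Gamma : tyenv V) (x : V) : option ty :=
  if Gamma.1 x is Some (A, j) then Some (shift (Gamma.2 - j) 0 A) else None.

Inductive typing (V : eqType) : tyenv V -> exp V -> ty -> Prop :=
| typing_int Gamma n : typing Gamma (EInt n) TInt
| typing_var Gamma x A :
    lookup Gamma x = Some A -> typing Gamma (EVar x) A
| typing_lam Gamma x A B e :
    typing (extend Gamma x A) e B -> typing Gamma (ELam x A e) (TFun A B)
| typing_fix Gamma x A B e :
    typing (extend Gamma x (TFun A B)) e (TFun A B) ->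
    typing Gamma (EFix x (TFun A B) e) (TFun A B)
| typing_app Gamma e e' A B :
    typing Gamma e (TFun A B) -> typing Gamma e' A ->
    typing Gamma (EApp e e') B
| typing_tyabs Gamma e A :
    typing (tyExtend Gamma) e A -> typing Gamma (ETyAbs e) (TAll A)
| typing_tyapp Gamma e A B :
    typing Gamma e (TAll A) -> typing Gamma (ETyApp e B) (subst 0 B A).

Definition env (V : Type) : Type := V -> option dom.

Definition apply (D1 D2 : set dom) : set dom :=
  d1 <~! D1 ;;
  d2 <~! D2 ;;
  match view d1 with
  | VTbl t =>
      p <~ [set p | p \in t] ;;
      if `[< p.1 ⊑ d2 >] then ddown p.2 else set0
  | _ => [set wrong]
  end.

Fixpoint iterate (V : eqType) (k : nat) (x : V) (L : env V -> set dom)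
    (rho : env V) : set dom :=
  match k with
  | 0 => set0
  | k'.+1 => d <~! iterate k' x L rho ;; L (pfun_upd rho x d)
  end.

(* A variable on which [rho] is undefined denotes the empty set. *)
Fixpoint sem (V : eqType) (e : exp V) (rho : env V) {struct e} : set dom :=
  match e with
  | EInt n => [set num n]
  | EOp op e1 e2 =>
      d1 <~! sem e1 rho ;;
      d2 <~! sem e2 rho ;;
      match view d1, view d2 with
      | VNum n1, VNum n2 => [set num (op n1 n2)]
      | _, _ => [set wrong]
      end
  | EVar x => if rho x is Some d then ddown d else set0
  | ELam x _ e =>
      ds <~ [set: {fset dom}] ;;
      t <~ mapM ds (fun d => d' <~ sem e (pfun_upd rho x d) ;; [set (d, d')]) ;;
      [set tbl t]
  | EApp e1 e2 => apply (sem e1 rho) (sem e2 rho)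
  | ETyAbs e =>
      if `[< sem e rho = set0 >] then [set thunk None]
      else (d <~! sem e rho ;; [set thunk (Some d)])
  | ETyApp e _ =>
      d <~! sem e rho ;;
      match view d with
      | VThunk None => set0
      | VThunk (Some d') => ddown d'
      | _ => [set wrong]
      end
  | EFix x _ e => k <~ [set: nat] ;; iterate k x (sem e) rho
  end.

Definition cleanup (D : set dom) : set dom :=
  [set d | exists2 d', D d' & d ⊑ d' /\ d <> wrong].

Fixpoint tysem (A : ty) (eta : seq (set dom)) {struct A} : set dom :=
  match A with
  | TInt => [set num n | n in [set: int]]
  | TVar i => if i < size eta then cleanup (nth set0 eta i) else set0
  | TFun A B =>
      [set tbl t | t in [set t : {fset dom * dom} | forall d1 d2',
         (d1, d2') \in t -> tysem A eta d1 ->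
         exists2 d2, tysem B eta d2 & d2' ⊑ d2]]
  | TAll A =>
      [set thunk (Some d) | d in [set d | forall D : set dom,
         tysem A (D :: eta) d]] `|` [set thunk None]
  end.

Inductive wt_env (V : eqType) :
    env V -> seq (set dom) -> tyenv V -> Prop :=
| wt_env_empty : wt_env (@pfun_empty V dom) [::] (tyenv_empty V)
| wt_env_extend rho eta Gamma x A v :
    wt_env rho eta Gamma -> tysem A eta v ->
    wt_env (pfun_upd rho x v) eta (extend Gamma x A)
| wt_env_tyExtend rho eta Gamma (D : set dom) :
    wt_env rho eta Gamma -> wt_env rho (D :: eta) (tyExtend Gamma).

(* Main.v *)
(* The sets [tysem A eta] are downward closed and never contain [wrong], so
   they are fixed by [cleanup]; hence instantiating a bound type variable with
   [tysem B eta] interprets type substitution, which is what type application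
   needs.  Soundness is then an induction on the typing derivation. *)
Require Import Defs.
From mathcomp Require Import all_boot ssrint finmap boolp classical_sets.

Set Implicit Arguments.
Unset Strict Implicit.
Unset Printing Implicit Defensive.

Local Open Scope classical_set_scope.

Lemma dle_refl d : d ⊑ d.
Proof.
by elim/dom_ind: d => [n|t _||d IHd|]; constructor => //; apply: fsubset_refl.
Qed.

(** [num], [tbl], [thunk] and [wrong] are not constructors of [dom]. In this and the next inversions
    the upper bound is therefore generalized with an equation, which [view] maps to one between
    constructors of [dview]. *)
Lemma dle_numE n d : d ⊑ num n -> d = num n.
Proof.
move E: (num n) => u du.
by case: du E => [m|t t' _||d1 d2 _|] // /(congr1 view); rewrite !viewE.
Qed.

Lemma dle_tblE t d :
  d ⊑ tbl t -> exists2 t', d = tbl t' & (t' `<=` t)%fset.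
Proof.
move E: (tbl t) => u du.
case: du E => [m|t1 t2 t12||d1 d2 _|] /(congr1 view); rewrite !viewE //.
by case=> ->; exists t1.
Qed.

Lemma dle_noneE d : d ⊑ thunk None -> d = thunk None.
Proof.
move E: (thunk None) => u du.
by case: du E => [m|t t' _||d1 d2 _|] // /(congr1 view); rewrite !viewE.
Qed.

Lemma dle_someE d' d :
  d ⊑ thunk (Some d') -> exists2 d0, d = thunk (Some d0) & d0 ⊑ d'.
Proof.
move E: (thunk (Some d')) => u du.
case: du E => [m|t1 t2 _||d1 d2 d12|] /(congr1 view); rewrite !viewE //.
by case=> ->; exists d1.
Qed.

Lemma dle_wrongE d : d ⊑ wrong -> d = wrong.
Proof.
move E: wrong => u du.
by case: du E => [m|t t' _||d1 d2 _|] // /(congr1 view); rewrite !viewE.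
Qed.

Lemma dle_trans d2 d1 d3 : d1 ⊑ d2 -> d2 ⊑ d3 -> d1 ⊑ d3.
Proof.
move=> + d23; elim: d23 d1 => {d2 d3}
  [n|t t' tt'||d d' _ IH|] d1.
- by move/dle_numE=> ->; apply: dle_refl.
- case/dle_tblE=> t0 -> t0t; constructor; exact: fsubset_trans tt'.
- by move/dle_noneE=> ->; apply: dle_refl.
- by case/dle_someE=> d0 -> /IH; constructor.
- by move/dle_wrongE=> ->; apply: dle_refl.
Qed.

Lemma dle_not_wrong d d' : d ⊑ d' -> d' <> wrong -> d <> wrong.
Proof.
by case=> // *; move/(congr1 view); rewrite !viewE.
Qed.

Lemma tysem_not_wrong A eta d : tysem A eta d -> d <> wrong.
Proof.
case: A => [|A B|A|i] /=.
- by case=> n _ <- /(congr1 view); rewrite !viewE.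
- by case=> t _ <- /(congr1 view); rewrite !viewE.
- by case=> [[d' _ <-]| ->] /(congr1 view); rewrite !viewE.
- by case: ifP => // _ [d' _ []].
Qed.

(** Tables are ordered by inclusion alone, so a smaller table has fewer pairs to check and no
    contravariance arises; at variables, [cleanup] closes downwards. *)
Lemma tysem_down A eta d d' : tysem A eta d -> d' ⊑ d -> tysem A eta d'.
Proof.
elim: A eta d d' => [|A _ B _|A IHA|i] eta d d' /=.
- by case=> n _ <- /dle_numE ->; exists n.
- case=> t tAB <- /dle_tblE [t' -> /fsubsetP t't].
  by exists t' => // d1 d2 /t't; apply: tAB.
- case=> [[d0 d0A <-] /dle_someE [d1 -> d10]| -> /dle_noneE ->]; last by right.
  by left; exists d1 => // D; apply: IHA d10; apply: d0A.
- case: ifP => // _ [d0 Dd0 [dd0 dNw]] d'd; exists d0 => //.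
  by split; [apply: dle_trans dd0 | apply: dle_not_wrong dNw].
Qed.

Lemma cleanup_tysem A eta : cleanup (tysem A eta) = tysem A eta.
Proof.
apply/seteqP; split=> [d [d' Ad' [/(tysem_down Ad')]] //|d Ad].
exists d => //; split; [exact: dle_refl | exact: tysem_not_wrong Ad].
Qed.

Lemma tysem_TFun A B A' B' eta eta' :
  tysem A eta = tysem A' eta' -> tysem B eta = tysem B' eta' ->
  tysem (TFun A B) eta = tysem (TFun A' B') eta'.
Proof. by move=> /= -> ->. Qed.

Lemma tysem_TAll A A' eta eta' :
  (forall D, tysem A (D :: eta) = tysem A' (D :: eta')) ->
  tysem (TAll A) eta = tysem (TAll A') eta'.
Proof.
move=> AA' /=; congr (_ `|` _); congr image.
by apply/funext => d; apply/propext; split=> dA D; move: (dA D); rewrite AA'.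
Qed.

(** The prefix [p] holds the values of the binders already crossed, so its size is the cutoff; [q]
    is the inserted block. *)
Lemma tysem_shift A p q eta :
  tysem (shift (size q) (size p) A) (p ++ q ++ eta) = tysem A (p ++ eta).
Proof.
elim: A p => [|A IHA B IHB|A IHA|i] p //.
- exact: tysem_TFun.
- by apply: tysem_TAll => D; apply: (IHA (D :: p)).
- rewrite /=; case: (ltnP i (size p)) => ip /=.
    by rewrite !nth_cat !size_cat ip !ltn_addr.
  have jp : size p <= i + size q by rewrite (leq_trans ip) ?leq_addr.
  rewrite !nth_cat !size_cat !ltnNge jp ip /=.
  rewrite -addnBAC // leq_addl /= addnK.
  by rewrite addnCA [i + _]addnC leq_add2l.
Qed.

Lemma tysem_subst A B p eta :
  tysem (subst (size p) B A) (p ++ eta) =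
  tysem A (p ++ tysem B (p ++ eta) :: eta).
Proof.
elim: A B p => [|A IHA A' IHA'|A IHA|i] B p //.
- exact: tysem_TFun.
- apply: tysem_TAll => D; rewrite (IHA _ (D :: p)) /=.
  (* The shift of [B] performed by [subst] under the binder compensates for the new entry [D]. *)
  by rewrite (tysem_shift B [::] [:: D]).
- rewrite /=; case: (ltngtP i (size p)) => [ip|pi|->] /=.
  + by rewrite !nth_cat !size_cat ip !ltn_addr.
  (* Here the index is a successor; [subst] decrements it because the entry for [B] disappears. *)
  + case: i pi => // i; rewrite ltnS => pi; rewrite !nth_cat !size_cat /=.
    rewrite [i < size p]ltnNge [i.+1 < size p]ltnNge pi leqW //=.
    by rewrite subSn //= addnS ltnS.
  + by rewrite nth_cat size_cat ltnn subnn /= addnS ltnS leq_addr cleanup_tysem.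
Qed.

(** A type recorded at depth [j] is interpreted in [eta] without its newest [Gamma.2 - j] entries;
    the shift made by [lookup] transports it to all of [eta]. *)
Lemma wt_env_lookup (V : eqType) (rho : env V) eta Gamma x A :
  wt_env rho eta Gamma -> lookup Gamma x = Some A ->
  exists2 v, rho x = Some v & tysem A eta v.
Proof.
move=> wt; pose inv (rho : env V) eta (Gamma : tyenv V) :=
  size eta = Gamma.2 /\
  forall A j, Gamma.1 x = Some (A, j) ->
  j <= Gamma.2 /\
  exists2 v, rho x = Some v & tysem A (drop (Gamma.2 - j) eta) v.
have [sz] : inv rho eta Gamma.
  elim: wt => {rho eta Gamma A} [|rho eta Gamma y B v _ [sz IH] Bv|
    rho eta Gamma D _ [sz IH]]; split => //=.
  - move=> A j; rewrite /pfun_upd; case: eqP => [_ [<- <-]|_]; last exact: IH.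
    by rewrite leqnn subnn drop0; split=> //; exists v.
  - by rewrite sz.
  - move=> A j /IH [jG IHv]; split; first exact: leqW.
    (* Since [j <= Gamma.2], one more entry is dropped, namely [D]. *)
    by rewrite subSn.
rewrite /lookup; case: (Gamma.1 x) => // -[B j] /(_ B j erefl) [jG [v -> Bv]].
case=> <-; exists v => //.
have := tysem_shift B [::] (take (Gamma.2 - j) eta) (drop (Gamma.2 - j) eta).
by rewrite /= cat_take_drop size_takel ?sz ?leq_subr // => ->.
Qed.

Lemma mem_mapM (A B : choiceType) (s : {fset A}) (f : A -> set B) t b :
  mapM s f t -> b \in t -> exists a, f a b.
Proof.
rewrite /mapM; elim: (enum_fset s) t => [|a l IHl] t /=.
  by move=> ->; rewrite in_fset0.
by case=> b' fab' [t' /IHl IHt' ->]; rewrite !inE => /orP [/eqP ->|/IHt'] //;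
  exists a.
Qed.

(** The branch of [wbind] that propagates [wrong] is never taken, as semantic types exclude
    [wrong]. *)
Lemma wbind_tysem A eta (m : set dom) k d :
  m `<=` tysem A eta -> wbind m k d -> exists2 a, tysem A eta a & k a d.
Proof.
move=> mA [a /mA Aa]; case: eqP => [/(tysem_not_wrong Aa)|_ kad] //.
by exists a.
Qed.

Theorem theorem6 (V : eqType) (e : exp V) (A : ty) (Gamma : tyenv V)
    (rho : env V) (eta : seq (set dom)) :
  typing Gamma e A -> wt_env rho eta Gamma ->
  sem e rho `<=` tysem A eta.
Proof.
move=> te; elim: te rho eta => {Gamma e A}
  [Gamma n|Gamma x A xA|Gamma x A B e _ IH|Gamma x A B e _ IH
  |Gamma e e' A B _ IHe _ IHe'|Gamma e A _ IH|Gamma e A B _ IH]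
  rho eta wt d.
- by move=> ->; exists n.
- by have [v /= -> Av] := wt_env_lookup wt xA; apply: tysem_down.
- case=> ds _ [t mt ->]; exists t => // d1 d2 d12 Ad1.
  (* Each pair records its own argument, so [d2] was computed by the body at [d1] itself. *)
  have [a [b eb [ad1 bd2]]] := mem_mapM mt d12; subst a b.
  exists d2; last exact: dle_refl.
  exact: (IH _ _ (wt_env_extend x wt Ad1)) eb.
(* Iteration starts from the empty set, and every approximation has the type that the body assumes
   for [x]. *)
- case=> k _; elim: k d => [|k IHk] d //= /(wbind_tysem IHk) [v ABv].
  exact: (IH _ _ (wt_env_extend x wt ABv)) d.
- case/(wbind_tysem (IHe _ _ wt)) => _ [t tAB <-].
  case/(wbind_tysem (IHe' _ _ wt)) => d2 Ad2.
  rewrite view_tbl => -[[d1 d'] /= d1d']; case: ifP => // /asboolP d12 dd'.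
  (* The table entry [d1] lies below the actual argument, hence in its type. *)
  have [b Bb d'b] := tAB _ _ d1d' (tysem_down Ad2 d12).
  exact: tysem_down Bb (dle_trans dd' d'b).
(* The set [sem e rho] is independent of [D], so each of its elements lies in every instance of
   [A]. *)
- have IHD D := IH _ _ (wt_env_tyExtend D wt).
  rewrite /=; case: ifP => _; first by right.
  case=> v ev; case: eqP => [vw|_ ->].
    by case: (tysem_not_wrong (IHD set0 _ ev)).
  by left; exists v => // D; apply: IHD.
- case/(wbind_tysem (IH _ _ wt)) => _ [[v Av <-]|->];
    rewrite view_thunk // => dv.
  (* The quantifier over [D] is instantiated with [tysem B eta]. *)
  rewrite (tysem_subst A B [::] eta).
  exact: tysem_down (Av _) dv.
Qed.
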